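(* Let $p$ be a prime, and let $a,l\in\mathbb N$ and $r\in\mathbb Z$. Then $$F_p(p^a(p-1)+l,r)\equiv F_p(l,r)\pmod{p^a},$$ $$F_p(2p^a(p-1)+l,r)\equiv2F_p(p^a(p-1)+l,r)-F_p(l,r)\pmod{p^{2a}},$$ $$F_p(3p^a(p-1)+l,r)\equiv3F_p(2p^a(p-1)+l,r)-3F_p(p^a(p-1)+l,r)+F_p(l,r)\pmod{p^{3a}}.$$
   Context: $\mathbb N=\{0,1,2,\ldots\}$. For a prime $p$, $n\in\mathbb N$ and $r\in\mathbb Z$, put $C_p(n,r)=\sum_{0\le k\le n,\ k\equiv r\,(\mathrm{mod}\ p)}\binom nk(-1)^k$. The Fleck quotient is $$F_p(n,r)=(-p)^{-\lfloor(n-1)/(p-1)\rfloor}C_p(n,r)+[\![n=0]\!],$$ where $[\![A]\!]$ is $1$ if the assertion $A$ holds and $0$ otherwise; it is an integer (Fleck). *)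

(* Defs.v *)
From mathcomp Require Import all_boot all_order all_algebra.

Set Implicit Arguments.
Unset Strict Implicit.
Unset Printing Implicit Defensive.

Import Order.TTheory GRing.Theory Num.Theory.
Local Open Scope ring_scope.

Definition fleckC (p n : nat) (r : int) : int :=
  \sum_(0 <= k < n.+1 | (k%:Z == r %[mod p%:Z])%Z) 'C(n, k)%:Z * (-1) ^+ k.

(* The exponent is an integer power: it equals 1 when n = 0, the floor being
   then -1. The division of int is the floor division, as p - 1 > 0. *)
Definition fleckQ (p n : nat) (r : int) : rat :=
  (- p%:R) ^ (- ((n%:Z - 1) %/ (p%:Z - 1))%Z) * (fleckC p n r)%:~R
  + (n == 0%N)%:R.

(* For p prime, fleckQ is integer valued (fleckE below), so the floor does not round. *)
Definition fleck (p n : nat) (r : int) : int := Num.floor (fleckQ p n r).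

Definition bdiff (m : nat) (f : int -> int) (r : int) : int :=
  \sum_(0 <= k < m.+1) 'C(m, k)%:Z * (-1) ^+ k * f (r - k%:Z).

Lemma bdiff0 f r : bdiff 0 f r = f r.
Proof. by rewrite /bdiff big_nat1 bin0 expr0 !mul1r subr0. Qed.

Lemma bdiffS m f r : bdiff m.+1 f r = bdiff m f r - bdiff m f (r - 1).
Proof.
rewrite /bdiff big_nat_recl //= !bin0.
under eq_bigr => k _ do rewrite binS PoszD !mulrDl.
rewrite big_split /= addrA; congr (_ + _).
  by rewrite [RHS]big_nat_recl // bin0 big_nat_recr //= bin_small // !mul0r [X in _ + X = _]addr0.
rewrite -sumrN; apply: eq_bigr => k _.
by rewrite exprS mulN1r mulrN mulNr -addn1 PoszD opprD addrA addrAC.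
Qed.

Lemma bdiffD m n f r : bdiff (m + n) f r = bdiff m (bdiff n f) r.
Proof.
elim: m r => [|m IHm] r; first by rewrite bdiff0.
by rewrite addSn !bdiffS !IHm.
Qed.

Lemma fleckCE p n r :
  fleckC p n r = bdiff n (fun t => ((p%:Z %| t)%Z : nat)%:Z) r.
Proof.
rewrite /fleckC /bdiff big_mkcond /=; apply: eq_bigr => k _.
by rewrite eq_sym eqz_mod_dvd; case: ifP => _; rewrite ?mulr1 ?mulr0.
Qed.

Lemma bdiff_period p n r (f := fun t => ((p%:Z %| t)%Z : nat)%:Z) :
  bdiff n f (r - p%:Z) = bdiff n f r.
Proof.
apply: eq_bigr => k _; rewrite /f; congr (_ * Posz (nat_of_bool _)).
by rewrite addrAC rpredBr ?dvdzz.
Qed.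

Lemma bdiff_prime p (f : int -> int) (d : int) : prime p ->
    (forall r, f (r - p%:Z) = f r) -> (forall r, (d %| f r - f (r - 1))%Z) ->
  forall r, (p%:Z * d %| bdiff p f r)%Z.
Proof.
move=> p_pr fp fd r.
have fdk k : (d %| f (r - k%:Z) - f r)%Z.
  elim: k => [|k IHk]; first by rewrite subr0 subrr dvdz0.
  have /(rpredB IHk) := fd (r - k%:Z).
  by rewrite opprB addrC addrA subrK -addrA -opprD -PoszD addn1.
have -> : bdiff p f r = bdiff p (fun t => f t - f r) r.
  have cst0 : bdiff p (fun=> f r) r = 0.
    by case: p p_pr {fp} => // m _; rewrite bdiffS subrr.
  rewrite -[LHS]subr0 -[in LHS]cst0 /bdiff -sumrB.
  by apply: eq_bigr => k _; rewrite mulrBr.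
rewrite /bdiff big_nat; apply: rpred_sum => k /andP[_ lekp].
have [->|k_gt0] := posnP k; first by rewrite subr0 subrr mulr0 dvdz0.
have [->|neq_kp] := eqVneq k p; first by rewrite fp subrr mulr0 dvdz0.
apply: dvdz_mul => //; apply: dvdz_mulr.
rewrite dvdzE /=; apply: prime_dvd_bin => //.
by rewrite k_gt0 ltn_neqAle neq_kp -ltnS.
Qed.

Lemma fleck_dvd p n r : prime p ->
  (p%:Z ^+ (n %/ p.-1) %| fleckC p n.+1 r)%Z.
Proof.
move=> p_pr; have p1_gt0 : (0 < p.-1)%N by rewrite -ltnS prednK ?prime_gt1 ?prime_gt0.
elim/ltn_ind: n r => n IHn r.
have [lt_np|le_pn] := ltnP n p.-1; first by rewrite divn_small // dvd1z.
rewrite -(subnKC le_pn) divnDl // divnn p1_gt0 add1n exprS.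
set m := (n - p.-1)%N.
rewrite -addnS addnC addSnnS prednK ?prime_gt0 // addnC fleckCE bdiffD.
apply: bdiff_prime => // [t|t]; first exact: bdiff_period.
by rewrite -bdiffS -fleckCE; apply: IHn; rewrite /m -subSn // leq_subLR -addn1 addnC leq_add.
Qed.

Lemma fleckE p n r : prime p -> (fleck p n r)%:~R = fleckQ p n r.
Proof.
move=> p_pr; suff [z fz] : exists z : int, fleckQ p n r = z%:~R by rewrite /fleck fz intrKfloor.
have p_gt1 := prime_gt1 p_pr.
have pE : p%:Z - 1 = (p.-1)%:Z by rewrite predn_int ?prime_gt0.
have pN0 : (- p%:R : rat) != 0 by rewrite oppr_eq0 pnatr_eq0 -lt0n prime_gt0.
case: n => [|n].
  have e : ((0%:Z - 1) %/ (p%:Z - 1))%Z = -1.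
    rewrite pE sub0r; case: (p) p_gt1 => [|[|m]] //= _.
  exists (- p%:Z * fleckC p 0 r + 1).
  by rewrite /fleckQ e opprK expr1z rmorphD rmorphM rmorphN.
have /dvdzP[q qE] := fleck_dvd n r p_pr.
exists ((-1) ^+ (n %/ p.-1) * q).
rewrite /fleckQ qE pE -[n.+1]addn1 PoszD addrK divz_nat addn1 addr0.
rewrite !rmorphM /= !rmorphXn /= rmorphN1 -exprnN [_%:~R * _ ^+ _]mulrC mulrA; congr (_ * _).
have -> : (p%:~R : rat) = -1 * - p%:R by rewrite mulN1r opprK.
by rewrite [X in _ * X]exprMn mulrCA mulVf ?mulr1 // expf_neq0.
Qed.

(* Main.v *)
(** Let [L P] be the sum of the coefficients of [P : {poly int}] whose index is
    congruent to [r] mod [p]: it vanishes on the multiples of [X^p - 1], and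
    [C_p(n,r) = L ((1-X)^n)]. With [Phi = 1 + X + ... + X^(p-1)], one has
    [(1-X)^(p-1) = Phi - p u] with [u(1) = 1], and [(1-X) Phi = -(X^p - 1)], so
    the Fleck quotient at [n+1] is [L ((1-X)^(s+1) u^t)], where [s] and [t] are
    the remainder and the quotient of [n] by [p-1]. Hence along the progression
    [m(p-1) + l] it has the form [c + L (u^m H)], and its k-th difference of
    step [p^a] is [L ((u^(p^a) - 1)^k ...)]. Finally [u^(p^a)] is congruent to
    [1] modulo [p^a (1-X)] and [X^p - 1], by induction on [a]: the extra factor
    [1-X] makes the last term of [(1 + t)^p] divisible by [p], since
    [(1-X)^p] is congruent to [-p (1-X) u] modulo [X^p - 1]. *)
Require Import Defs.
From HB Require Import structures.
From mathcomp Require Import all_boot all_order all_algebra.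
From mathcomp Require Import ring zify.

Import GRing.Theory Num.Theory.
Local Open Scope ring_scope.

(** * Coefficient sums over a residue class *)

Definition residue_sum (p : nat) (r : int) (P : {poly int}) : int :=
  \sum_(i < size P) P`_i * ((i%:Z == r %[mod p%:Z])%Z : nat)%:Z.

Lemma residue_sum_widen p r (P : {poly int}) n : (size P <= n)%N ->
  residue_sum p r P =
    \sum_(i < n) P`_i * ((i%:Z == r %[mod p%:Z])%Z : nat)%:Z.
Proof.
move=> le_Pn; rewrite /residue_sum.
rewrite (big_ord_widen n
  (fun i => P`_i * ((i%:Z == r %[mod p%:Z])%Z : nat)%:Z)) //.
rewrite big_mkcond; apply: eq_bigr => i _; case: ltnP => // le_Pi.
by rewrite nth_default // mul0r.
Qed.

Lemma residue_sum_is_scalar p r : scalar (residue_sum p r).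
Proof.
move=> a P Q; pose n := maxn (size P) (size Q).
have leP : (size P <= n)%N by rewrite leq_maxl.
have leQ : (size Q <= n)%N by rewrite leq_maxr.
have leS : (size (a *: P + Q)%R <= n)%N.
  apply: leq_trans (size_polyD _ _) _; rewrite geq_max leQ andbT.
  exact: leq_trans (size_scale_leq _ _) leP.
rewrite !(@residue_sum_widen p r _ n) // mulr_sumr -big_split.
by apply: eq_bigr => i _; rewrite /= coefD coefZ mulrDl mulrA.
Qed.

HB.instance Definition _ p r :=
  GRing.isLinear.Build int {poly int} int *%R (residue_sum p r)
    (residue_sum_is_scalar p r).

Lemma residue_sumXn p r n :
  residue_sum p r 'X^n = ((n%:Z == r %[mod p%:Z])%Z : nat)%:Z.
Proof.
rewrite (@residue_sum_widen p r _ n.+1) ?size_polyXn // big_ord_recr /=.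
rewrite big1 ?add0r ?coefXn ?eqxx ?mul1r // => i _.
by rewrite coefXn ltn_eqF ?mul0r.
Qed.

Lemma residue_sum_period p r (P : {poly int}) :
  residue_sum p r (('X^p - 1) * P) = 0.
Proof.
rewrite -[P]coefK poly_def mulr_sumr raddf_sum big1 //= => i _.
rewrite -scalerAr linearZ /= mulrBl mul1r -exprD raddfB /= !residue_sumXn.
by rewrite PoszD modzDl subrr mulr0.
Qed.

Lemma fleckC_residue_sum p n r : fleckC p n r = residue_sum p r ((1 - 'X) ^+ n).
Proof.
rewrite exprBn raddf_sum /fleckC big_mkcond big_mkord; apply: eq_bigr => k _.
have -> : (-1) ^+ k * 1 ^+ (n - k) * 'X^k = ((-1) ^+ k : int) *: 'X^k.
  by rewrite expr1n mulr1 -mul_polyC rmorphXn rmorphN1.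
rewrite raddfMn /= linearZ /= residue_sumXn -mulr_natl natz.
by case: ifP => _; rewrite ?mulr0 ?mulr1.
Qed.

(** Exactly one exponent among [0], ..., [p - 1] lies in the class of [r]. *)
Lemma residue_sum_geometric p r : (0 < p)%N ->
  residue_sum p r (\sum_(i < p) 'X^i) = 1.
Proof.
move=> p_gt0; have p_neq0 : p%:Z != 0 by lia.
have [k rk lt_kp] : exists2 k : nat, (r %% p%:Z)%Z = k%:Z & (k < p)%N.
  exists `|(r %% p%:Z)%Z|%N; move: (modz_ge0 r p_neq0) (ltz_mod r p_neq0); lia.
rewrite raddf_sum /= (bigD1 (Ordinal lt_kp)) //= residue_sumXn.
rewrite rk modz_nat modn_small // eqxx big1 ?addr0 // => i neq_ik.
rewrite residue_sumXn rk modz_nat modn_small //.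
by rewrite (_ : (_ == _) = false) //; apply/negbTE.
Qed.

(** * Binomial expansions with explicit cofactors *)

Lemma exprD1_prime (R : comPzRingType) p (t : R) : prime p ->
  exists s, (1 + t) ^+ p = 1 + p%:R * t * s + t ^+ p.
Proof.
case: p => // q p_pr; exists (\sum_(i < q) t ^+ i *+ ('C(q.+1, i.+1) %/ q.+1)).
rewrite exprDn big_ord_recl big_ord_recr /= bin0 binn expr1n subnn !mul1r addrA.
congr (_ + _ + _); rewrite mulr_sumr; apply: eq_bigr => i _.
rewrite expr1n mul1r /bump /= add1n.
rewrite -[in LHS](@divnK q.+1 'C(q.+1, i.+1)); last first.
  by apply: prime_dvd_bin => //; apply: ltn_ord.
rewrite exprS -[LHS]mulr_natl -[X in _ = _ * X]mulr_natl natrM; ring.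
Qed.

(** A difference of n-th powers is a multiple of the difference [y * z] of the bases. This serves to
    discard multiples of [X^p - 1] or of [Phi] inside a power. *)
Lemma exprD_mull (R : comPzRingType) (x y z : R) n :
  exists z', (x + y * z) ^+ n = x ^+ n + y * z'.
Proof.
exists (z * \sum_(i < n) (x + y * z) ^+ (n.-1 - i) * x ^+ i).
rewrite [RHS]addrC; apply: (canRL (subrK _)); rewrite subrXX mulrA; congr (_ * _).
by rewrite [X in X - _]addrC addrK.
Qed.

(** * The polynomial [u] and its powers *)

Lemma mul1BX_geometric p :
  (1 - 'X) * \sum_(i < p) 'X^i = - ('X^p - 1) :> {poly int}.
Proof. by rewrite subrX1 -mulNr opprB. Qed.

Lemma polyC_Posz n : (Posz n)%:P = n%:R :> {poly int}.
Proof. by rewrite -polyC_natr natz. Qed.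

(** Modulo [p], [(1-X)^p] is [1 - X^p]. The error [p * g] vanishes at 1, so [g = u * (X-1)], and
    cancelling [1-X] yields the identity. *)
Lemma cyclotomic_unit p : prime p ->
  exists2 u : {poly int},
    (1 - 'X) ^+ p.-1 = \sum_(i < p) 'X^i - p%:R * u & u.[1] = 1.
Proof.
move=> p_pr; have p_gt0 := prime_gt0 p_pr; have p_gt1 := prime_gt1 p_pr.
have [e eE] : exists e : {poly int}, (- 'X) ^+ p = - 'X^p + p%:R * e.
  (* For [p = 2] the sign is wrong: [X^2 = - X^2 + 2 X^2]. *)
  have [->|odd_p] := even_prime p_pr; first by exists 'X^2; ring.
  by exists 0; rewrite mulr0 addr0 exprNn -signr_odd odd_p expr1 mulN1r.
have [s sE] := exprD1_prime {poly int} p (- 'X) p_pr.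
have [g gE] : exists g : {poly int}, (1 - 'X) ^+ p = - ('X^p - 1) + p%:R * g.
  by exists (e - 'X * s); rewrite sE eE; ring.
have p0 : (p%:R : int) != 0 by rewrite pnatr_eq0 -lt0n.
have natE : (p%:R : {poly int}).[1] = p%:R by rewrite -polyC_natr hornerC.
have /factor_theorem[u uE] : root g 1.
  have := congr1 (horner^~ 1) gE.
  rewrite hornerD hornerM natE !hornerE expr1n !subrr expr0n gtn_eqF //.
  by rewrite oppr0 add0r => /esym/eqP; rewrite mulf_eq0 (negbTE p0).
have hu : (1 - 'X) ^+ p.-1 = \sum_(i < p) 'X^i - p%:R * u.
  have Y0 : (1 - 'X : {poly int}) != 0 by rewrite -oppr_eq0 opprB -polyC1 polyXsubC_eq0.
  apply: (mulfI Y0); rewrite -exprS prednK // gE uE [RHS]mulrBr mul1BX_geometric.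
  rewrite polyC1; ring.
(* At 1 the identity reads [0 = p - p * u(1)]. *)
exists u => //; have := congr1 (horner^~ 1) hu.
rewrite [RHS]hornerD hornerN hornerM natE !hornerE horner_sum subrr expr0n gtn_eqF ?ltn_predRL //.
under eq_bigr => i _ do rewrite hornerXn expr1n.
rewrite sumr_const card_ord => /esym/eqP; rewrite subr_eq0 -[X in X == _]mulr1 => /eqP.
by move/(mulfI p0).
Qed.

Lemma cyclotomic_unit_expr p (u : {poly int}) a : prime p ->
    (1 - 'X) ^+ p.-1 = \sum_(i < p) 'X^i - p%:R * u -> u.[1] = 1 ->
  exists w z : {poly int},
    u ^+ (p ^ a) = 1 + (p ^ a)%:R * (1 - 'X) * w + ('X^p - 1) * z.
Proof.
move=> p_pr hu u1; elim: a => [|a [w [z IHa]]].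
  have /factor_theorem[q qE] : root (u - 1) 1 by rewrite /root !hornerE u1 subrr.
  exists (- q), 0; move/eqP: qE; rewrite subr_eq => /eqP ->.
  rewrite expn0 expr1 polyC1; ring.
set t := (p ^ a)%:R * (1 - 'X) * w in IHa.
have [s sE] := exprD1_prime _ p t p_pr.
have [z' z'E] := exprD_mull _ (1 + t) ('X^p - 1) z p.
rewrite -IHa -exprM -expnSr in z'E.
(* Here [(1-X)^p = (1-X) (Phi - p u) = - (X^p - 1) - p (1-X) u]; its factor [p], with one factor
   [p^a] of [(p^a)^p], gives the required [p^(a+1)]. *)
have tp : t ^+ p = - (p ^ a)%:R * (p ^ a)%:R ^+ p.-1 * w ^+ p
    * ('X^p - 1 + p%:R * (1 - 'X) * u).
  have expr_pred (x : {poly int}) : x ^+ p = x * x ^+ p.-1.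
    by rewrite -exprS prednK ?prime_gt0.
  rewrite /t !exprMn (expr_pred (1 - 'X)) (expr_pred _%:R) hu.
  rewrite mulrBr mul1BX_geometric; ring.
exists (w * s - (p ^ a)%:R ^+ p.-1 * w ^+ p * u),
       (z' - (p ^ a)%:R * (p ^ a)%:R ^+ p.-1 * w ^+ p).
rewrite z'E sE tp expnS natrM /t; ring.
Qed.

(** * Fleck quotients along the progression *)

Lemma fleck_residue_sum p (u : {poly int}) n r : prime p ->
    (1 - 'X) ^+ p.-1 = \sum_(i < p) 'X^i - p%:R * u ->
  fleck p n.+1 r =
    residue_sum p r ((1 - 'X) ^+ (n %% p.-1).+1 * u ^+ (n %/ p.-1)).
Proof.
move=> p_pr hu; set s := (n %% _)%N; set t := (n %/ _)%N.
apply: (@intr_inj rat); rewrite fleckE // /fleckQ addr0.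
have pE : p%:Z - 1 = (p.-1)%:Z by rewrite predn_int ?prime_gt0.
rewrite pE -[n.+1]addn1 PoszD addrK divz_nat addn1 -/t fleckC_residue_sum.
have [z zE] : exists z : {poly int}, (1 - 'X) ^+ n.+1 =
    (- p%:Z) ^+ t *: ((1 - 'X) ^+ s.+1 * u ^+ t) + ('X^p - 1) * z.
  have [z zE] : exists z : {poly int}, (1 - 'X) ^+ p.-1 ^+ t =
      (- (p%:R * u)) ^+ t + (\sum_(i < p) 'X^i) * z.
    have [z] := exprD_mull _ (- (p%:R * u)) (\sum_(i < p) 'X^i) 1 t.
    by rewrite mulr1 [- _ + \sum_(i < p) _]addrC -hu => zE; exists z.
  (* One factor of [(1-X)^(s+1)] turns [Phi * z] into a multiple of [X^p - 1]. *)
  exists (- ((1 - 'X) ^+ s * z)).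
  rewrite {1}(divn_eq n p.-1) -/t -/s -addnS exprD mulnC exprM zE.
  rewrite -mul_polyC rmorphXn rmorphN /= polyC_Posz -mulNr exprMn exprS.
  rewrite -['X^p - 1]opprK -mul1BX_geometric; ring.
rewrite zE raddfD /= residue_sum_period addr0 linearZ /= rmorphM rmorphXn rmorphN /=.
rewrite -exprnN mulrA mulVf ?mul1r // expf_neq0 // oppr_eq0.
by rewrite pnatr_eq0 -lt0n prime_gt0.
Qed.

Lemma fleck_progression p (u : {poly int}) l r : prime p ->
    (1 - 'X) ^+ p.-1 = \sum_(i < p) 'X^i - p%:R * u -> u.[1] = 1 ->
  exists c H, forall m,
    fleck p (m * (p - 1) + l) r = c + residue_sum p r (u ^+ m * H).
Proof.
move=> p_pr hu u1; have p1_gt0 : (0 < p.-1)%N by rewrite ltn_predRL prime_gt1.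
have p_gt0 := prime_gt0 p_pr; rewrite subn1.
case: l => [|l]; last first.
  exists 0, ((1 - 'X) ^+ (l %% p.-1).+1 * u ^+ (l %/ p.-1)) => m.
  rewrite addnS (fleck_residue_sum _ u) // add0r; congr residue_sum.
  by rewrite modnMDl divnMDl // exprD; ring.
(* At [l = 0], [m >= 1], with [P = (1-X)^(p-1) u^(m-1) = Phi u^(m-1) - p u^m],
   the first term contributes [L Phi = 1], as [u^(m-1)] is [1] mod [1-X]. *)
exists 1, (- p%:R) => m; rewrite addn0; case: m => [|m].
  (* At index 0 the floor is -1, so the power of [-p] is [-p] itself, which explains [H]; the
     bracket for [n = 0] supplies [c = 1]. *)
  rewrite mul0n expr0 mul1r; apply: (@intr_inj rat); rewrite fleckE // /fleckQ.
  have pE : p%:Z - 1 = (p.-1)%:Z by rewrite predn_int.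
  have -> : ((0%:Z - 1) %/ (p%:Z - 1))%Z = -1.
    by rewrite pE sub0r; case: (p.-1) p1_gt0.
  rewrite opprK expr1z fleckC_residue_sum expr0 addrC rmorphD /=; congr (_ + _).
  have -> : - p%:R = (- p%:Z) *: (1 : {poly int}).
    by rewrite -mul_polyC mulr1 rmorphN /= polyC_Posz.
  by rewrite linearZ /= rmorphM rmorphN.
have nE : (m.+1 * p.-1 = (m * p.-1 + p.-1.-1).+1)%N by rewrite mulSn addnC -addnS prednK.
rewrite nE (fleck_residue_sum _ u) // modnMDl divnMDl // modn_small ?ltn_predL //.
rewrite divn_small ?ltn_predL // addn0 prednK // hu.
have /factor_theorem[z zE] : root (u ^+ m - 1) 1.
  by rewrite /root !hornerE u1 expr1n subrr.
have -> : (\sum_(i < p) 'X^i - p%:R * u) * u ^+ m =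
    \sum_(i < p) 'X^i + ('X^p - 1) * z + u ^+ m.+1 * - p%:R.
  rewrite mulrBl -[in X in X - _](subrK 1 (u ^+ m)) zE exprS.
  rewrite -['X^p - 1]opprK -mul1BX_geometric polyC1; ring.
by rewrite !raddfD /= residue_sum_period residue_sum_geometric // addr0.
Qed.

(** Modulo [X^p - 1], the k-th power is [(p^a (1-X) w)^k], and linearity extracts the constant
    [p^(ka)]. *)
Lemma dvdz_residue_sum_unit p (u : {poly int}) a k H r : prime p ->
    (1 - 'X) ^+ p.-1 = \sum_(i < p) 'X^i - p%:R * u -> u.[1] = 1 ->
  ((p ^ (k * a))%N%:Z %| residue_sum p r ((u ^+ (p ^ a) - 1) ^+ k * H))%Z.
Proof.
move=> p_pr hu u1; have [w [z ->]] := cyclotomic_unit_expr p u a p_pr hu u1.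
set v := _ * w; have -> y : 1 + v + y - 1 = v + y by ring.
have [z' ->] := exprD_mull _ v ('X^p - 1) z k.
rewrite mulrDl -[_ * z' * H]mulrA raddfD /= residue_sum_period addr0 /v.
rewrite -mulrA exprMn -natrX -expnM [(a * k)%N]mulnC -mulrA.
by rewrite mulr_natl raddfMn /= -mulr_natl natz dvdz_mulr.
Qed.

Theorem corollary1p7 (p : nat) (hp : prime p) (a l : nat) (r : int) :
  [/\ (fleck p (p ^ a * (p - 1) + l)%N r
         = fleck p l r
         %[mod (p ^ a)%N%:Z])%Z,
      (fleck p (2 * p ^ a * (p - 1) + l)%N r
         = 2 * fleck p (p ^ a * (p - 1) + l)%N r - fleck p l r
         %[mod (p ^ (2 * a))%N%:Z])%Z
    & (fleck p (3 * p ^ a * (p - 1) + l)%N r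
         = 3 * fleck p (2 * p ^ a * (p - 1) + l)%N r
           - 3 * fleck p (p ^ a * (p - 1) + l)%N r + fleck p l r
         %[mod (p ^ (3 * a))%N%:Z])%Z].
Proof.
have [u hu u1] := cyclotomic_unit p hp.
have [c [H fE]] := fleck_progression p u l r hp hu u1.
have f0 : fleck p l r = c + residue_sum p r H.
  by rewrite -(mul1r H) -(expr0 u) -fE.
have dvd k := dvdz_residue_sum_unit p u a k H r hp hu u1.
rewrite !fE f0 ![(_ * p ^ a)%N]mulnC !exprM.
(* With [v = u^(p^a)], the congruences are the cases [k = 1, 2, 3] of the divisibility of the
   residue sum of [(v-1)^k H]. The constant [c] cancels, as the signed binomial coefficients add up
   to 0. *)
move: (u ^+ (p ^ a)) dvd => v dvd.
split; apply/eqP; rewrite eqz_mod_dvd.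
- have := dvd 1%N; rewrite mul1n.
  have -> : (v - 1) ^+ 1 * H = v * H - H by ring.
  rewrite raddfB /=; congr (dvdz _ _); ring.
- have := dvd 2%N.
  have -> : (v - 1) ^+ 2 * H = v ^+ 2 * H - (v * H) *+ 2 + H by ring.
  rewrite raddfD raddfB raddfMn /=; congr (dvdz _ _); ring.
- have := dvd 3%N.
  have -> : (v - 1) ^+ 3 * H = v ^+ 3 * H - (v ^+ 2 * H) *+ 3 + (v * H) *+ 3 - H by ring.
  rewrite raddfB raddfD raddfB !raddfMn /=; congr (dvdz _ _); ring.
Qed.
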